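(* Fix an equation $(f,q,w)$ as in the context with $\prod_{i=0}^{N-1}(1/f_i)>0$. Let $\gamma\in(-\pi,0)\cup(0,\pi)$ and $K=(k_{ij})\in SL(2,\mathbb R)$ with $k_{11}-f_0k_{12}\neq0$. Let $\mathbf V_K=\begin{pmatrix}k_{21}&k_{22}&0&0\\0&0&0&1\end{pmatrix}$. For $M\in\{K,-K\}$ with entries $m_{ij}$, write $\lambda_j(M)$, $\lambda_j(-M)$, $\lambda_j(e^{i\gamma}M)$, $\lambda_j(\mathbf V_K)$ for the eigenvalues with boundary conditions $[M|-I]$, $[-M|-I]$, $[e^{i\gamma}M|-I]$, $\mathbf V_K$; put $m_j=\min\{\lambda_j(M),\lambda_j(-M)\}$, $M_j=\max\{\lambda_j(M),\lambda_j(-M)\}$; and say $P(M)$ holds if for every $0\le j\le N-1$: $\lambda_j(M)<\lambda_j(e^{i\gamma}M)<\lambda_j(-M)$ for $j$ even and $\lambda_j(-M)<\lambda_j(e^{i\gamma}M)<\lambda_j(M)$ for $j$ odd. Then for each $M\in\{K,-K\}$: (i) if $m_{11}-f_0m_{12}>0$ and $f_0m_{22}-m_{21}>0$: $P(M)$ holds, $\lambda_j(\mathbf V_K)\le m_j$ for $0\le j\le N-1$, and $M_j\le\lambda_{j+1}(\mathbf V_K)$ for $0\le j\le N-2$; (ii) if $m_{11}-f_0m_{12}>0$ and $f_0m_{22}-m_{21}<0$: $P(M)$ holds, $M_j\le\lambda_j(\mathbf V_K)\le m_{j+1}$ for $0\le j\le N-2$, and $M_{N-1}\le\lambda_{N-1}(\mathbf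 V_K)$; (iii) if $m_{11}-f_0m_{12}>0$ and $f_0m_{22}-m_{21}=0$: $P(M)$ holds and $M_j\le\lambda_j(\mathbf V_K)\le m_{j+1}$ for $0\le j\le N-2$.
   Context: Let $N\ge2$ be an integer. An equation is given by real sequences $f=\{f_n\}_{n=0}^N$, $q=\{q_n\}_{n=1}^N$, $w=\{w_n\}_{n=1}^N$ with $f_n\neq0$, $w_n>0$; it is $-\nabla(f_n\Delta y_n)+q_ny_n=\lambda w_ny_n$, $1\le n\le N$, for $y=\{y_n\}_{n=0}^{N+1}$, $\Delta y_n=y_{n+1}-y_n$, $\nabla y_n=y_n-y_{n-1}$. A boundary condition $[A\,|\,B]$ (equivalently the $2\times4$ coefficient matrix $(A,B)$ of rank 2) is $A(y_0,f_0\Delta y_0)^T+B(y_N,f_N\Delta y_N)^T=0$; matrices differing by left multiplication by an invertible $2\times2$ complex matrix give the same condition (so $\mathbf V_{-K}=\mathbf V_K$). $SL(2,\mathbb R)$: real $2\times2$ matrices of determinant 1; $I$ the identity. Eigenvalues ($\lambda$ with a nontrivial solution) are real; multiplicity = dimension of the solution space; counted with multiplicity they are ordered $\lambda_0\le\lambda_1\le\cdots$. *)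

(* Defs.v *)
From HB Require Import structures.
From mathcomp Require Import all_boot all_order all_algebra.
From mathcomp Require Import complex.
From mathcomp Require Import boolp classical_sets reals trigo.

Set Implicit Arguments.
Unset Strict Implicit.
Unset Printing Implicit Defensive.

Import Order.TTheory GRing.Theory Num.Theory.
Local Open Scope ring_scope.
Local Open Scope complex_scope.

Section SL.
Variables (R : realType) (N : nat) (f q w : nat -> R).

Local Notation C := R[i].
Local Notation c x := ((x : R)%:C : C).

(* Boundary condition [A | B]:  A (y_0, f_0 Δy_0)^T + B (y_N, f_N Δy_N)^T = 0,
   A B : 2x2 complex matrices (i.e. the 2x4 matrix (A,B)). *)

(* The linear system (in the unknown y = (y_0, ..., y_{N+1}) in C^(N+2))
   for the spectral parameter lam : row 0 and row N+1 are the two boundary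
   equations, rows n = 1..N are the difference equation
   -∇(f_n Δy_n) + q_n y_n - lam w_n y_n = 0. *)
Definition sl_sys (A B : 'M[C]_2) (lam : R) (y : 'I_N.+2 -> C) (i : 'I_N.+2) : C :=
  let Y n := y (inord n) in
  let Df n := c (f n) * (Y n.+1 - Y n) in
  let bc (r : 'I_2) :=
      A r 0 * Y 0%N + A r 1 * Df 0%N + B r 0 * Y N + B r 1 * Df N in
  if val i == 0%N then bc 0
  else if val i == N.+1 then bc 1
  else - (Df (val i) - Df (val i).-1) + c (q (val i)) * Y (val i)
       - c lam * c (w (val i)) * Y (val i).

Definition sl_mx (A B : 'M[C]_2) (lam : R) : 'M[C]_N.+2 :=
  \matrix_(i, j) sl_sys A B lam (fun k => (k == j)%:R) i.

(* multiplicity of lam = dimension of the solution space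
   { y in C^(N+2) | sl_mx *m y = 0 }  (rows u with u *m sl_mx^T = 0). *)
Definition sl_mult (A B : 'M[C]_2) (lam : R) : nat :=
  \rank (kermx (sl_mx A B lam)^T).

Definition is_eig_list (A B : 'M[C]_2) (s : seq R) : Prop :=
  sorted <=%R s /\ forall mu : R, count_mem mu s = sl_mult A B mu.

Definition eig_list (A B : 'M[C]_2) : seq R :=
  xget [::] (fun s => is_eig_list A B s).

Definition eig (A B : 'M[C]_2) (j : nat) : R := nth 0 (eig_list A B) j.

End SL.

Definition cmx (R : realType) (M : 'M[R]_2) : 'M[R[i]]_2 :=
  map_mx (fun x => (x%:C)%C) M.

Definition expi (R : realType) (g : R) : R[i] := (cos g +i* sin g)%C.

(* V_K = ( k21 k22 0 0 ; 0 0 0 1 ), split as [A | B] *)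
Definition VK_A (R : realType) (K : 'M[R]_2) : 'M[R[i]]_2 :=
  \matrix_(i < 2, j < 2) (if (val i == 0%N) then ((K 1 j)%:C)%C else 0).
Definition VK_B (R : realType) : 'M[R[i]]_2 :=
  \matrix_(i < 2, j < 2) (if (val i == 1%N) && (val j == 1%N) then 1 else 0).

(* Main.v *)
(** Eliminating [y_0] and [y_{N+1}] turns each boundary problem into a Hermitian
    pencil [H - lam W] on [(y_1, ..., y_N)], where [W = diag w].  For
    [e^{i gamma} M | -I] the matrix [H] is a Jacobi matrix with two extra corner
    entries [- (f_0 / a) e^{+- i gamma}]; only these depend on [gamma]; passing
    from [M] to [-M] is the case [gamma = pi].  Writing [a = m_11 - f_0 m_12] and
    [b = f_0 m_22 - m_21], the form of the coupled problem minus that of [V_K] is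
    [(b / a) |t|^2] for one linear form [t] when [b <> 0], and for [b = 0] the
    problem [V_K] is the compression to [y_1 = 0]; the comparisons with
    [lam_j (V_K)] are thus rank-one (Weyl) or compression (Cauchy) interlacing.
    For the comparison among the coupled problems, any two of the forms agree on
    [y_1 = 0], so their spectra interlace up to one index, while
    [det (H - lam W) = G (lam) - 2 p cos gamma] where [p = (f_0 ... f_{N-1}) / a > 0]:
    the sign of the product of the [mu_k - lam_j] then decides, according to the
    parity of [j], which of the two [j]-th eigenvalues is smaller. *)
Require Import Defs.
From HB Require Import structures.
From mathcomp Require Import all_boot all_order all_algebra.
From mathcomp Require Import complex.
From mathcomp Require Import boolp classical_sets reals trigo.
From mathcomp Require Import perm zify ring lra.
Set Implicit Arguments.
Unset Strict Implicit.
Unset Printing Implicit Defensive.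
Import Order.TTheory GRing.Theory Num.Theory.
Local Open Scope ring_scope.
Local Open Scope sesquilinear_scope.

(** * Hermitian pencils: Rayleigh quotients and simultaneous diagonalization *)

Section HermitianPencils.
Variable C : numClosedFieldType.
Implicit Types (m n p r : nat).

Lemma adjmxM m n p (A : 'M[C]_(m, n)) (B : 'M_(n, p)) :
  (A *m B)^t* = B^t* *m A^t*.
Proof. by rewrite trmx_mul map_mxM. Qed.

Lemma mulmx_adj_ge0 n (x : 'rV[C]_n) : 0 <= (x *m x^t*) 0 0.
Proof. by rewrite mxE sumr_ge0 // => i _; rewrite !mxE -normCK exprn_ge0. Qed.

Lemma mulmx_adj_eq0 n (x : 'rV[C]_n) : (x *m x^t*) 0 0 = 0 -> x = 0.
Proof.
rewrite mxE => /eqP; rewrite psumr_eq0 => [/allP h|i _]; last first.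
  by rewrite !mxE -normCK exprn_ge0.
apply/rowP => i; rewrite mxE; have := h i (mem_index_enum i).
by rewrite !mxE -normCK expf_eq0 normr_eq0 /= => /eqP.
Qed.

Lemma diag_form n (d x : 'rV[C]_n) :
  (x *m diag_mx d *m x^t*) 0 0 = \sum_i d 0 i * `|x 0 i| ^+ 2.
Proof.
rewrite mxE; apply: eq_bigr => i _.
by rewrite mul_mx_diag !mxE normCK mulrAC mulrC.
Qed.

Lemma diag_form_ge n (d x : 'rV[C]_n) a : (forall i, a <= d 0 i) ->
  a * (x *m x^t*) 0 0 <= (x *m diag_mx d *m x^t*) 0 0.
Proof.
move=> ad; rewrite diag_form mxE mulr_sumr; apply: ler_sum => i _.
by rewrite !mxE -normCK ler_wpM2r // exprn_ge0.
Qed.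

Lemma diag_form_le n (d x : 'rV[C]_n) a : (forall i, d 0 i <= a) ->
  (x *m diag_mx d *m x^t*) 0 0 <= a * (x *m x^t*) 0 0.
Proof.
move=> ad; rewrite diag_form mxE mulr_sumr; apply: ler_sum => i _.
by rewrite !mxE -normCK ler_wpM2r // exprn_ge0.
Qed.

Lemma form_mul m n (X : 'M[C]_(m, n)) (A : 'M_n) (c : 'rV_m) :
  c *m X *m A *m (c *m X)^t* = c *m (X *m A *m X^t*) *m c^t*.
Proof. by rewrite adjmxM !mulmxA. Qed.

(* The two row spaces and the kernel of [L] meet nontrivially for dimension
   reasons; the Rayleigh quotients at a common vector give the inequality. *)
Lemma rayleigh_le n d p r (A B W : 'M[C]_n) (L : 'M_(n, d))
    (V1 : 'M_(p, n)) (V2 : 'M_(r, n)) (d1 : 'rV_p) (d2 : 'rV_r) a b :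
  V1 *m W *m V1^t* = 1%:M -> V1 *m A *m V1^t* = diag_mx d1 ->
  V2 *m W *m V2^t* = 1%:M -> V2 *m B *m V2^t* = diag_mx d2 ->
  (forall x : 'rV_n, x *m L = 0 ->
     (x *m A *m x^t*) 0 0 <= (x *m B *m x^t*) 0 0) ->
  (forall i, a <= d1 0 i) -> (forall i, d2 0 i <= b) ->
  (n + d < p + r)%N -> a <= b.
Proof.
move=> W1 A1 W2 B2 AB ad1 d2b ltd.
(* A row [(c1, c2)] in the left kernel of [Z] encodes a common vector [c1 V1 = c2 V2] annihilated by
   [L]; more rows than columns make this kernel nonzero. *)
pose Z : 'M_(p + r, n + d) := block_mx V1 (V1 *m L) (- V2) 0.
have : kermx Z != 0.
  rewrite kermx_eq0 -row_leq_rank -ltnNge.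
  exact: leq_ltn_trans (rank_leq_col _) ltd.
case/rowV0Pn=> c /sub_kermxP cZ c0.
rewrite -[c]hsubmxK mul_row_block mulmx0 addr0 -row_mx0 in cZ.
have [] := eq_row_mx cZ; set c1 := lsubmx c; set c2 := rsubmx c => e1 e2.
have e : c1 *m V1 = c2 *m V2.
  by apply/eqP; rewrite -subr_eq0 -mulmxN e1.
have xL : c1 *m V1 *m L = 0 by rewrite -mulmxA.
(* By [W]-orthonormality both coefficient rows have the [W]-norm of the common vector, so neither
   vanishes without the other. *)
have nx : c1 *m c1^t* = c2 *m c2^t*.
  have := form_mul V1 W c1.
  by rewrite W1 mulmx1 => <-; rewrite e form_mul W2 mulmx1.
have pos : 0 < (c1 *m c1^t*) 0 0.
  rewrite lt_def mulmx_adj_ge0 andbT; apply: contra c0 => /eqP h.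
  have c10 := mulmx_adj_eq0 h; rewrite nx in h.
  by rewrite -[c]hsubmxK -/c1 -/c2 c10 (mulmx_adj_eq0 h) row_mx0.
rewrite -(ler_pM2r pos); apply: le_trans (diag_form_ge c1 ad1) _.
rewrite nx; apply: le_trans (diag_form_le c2 d2b).
by rewrite -A1 -B2 -!form_mul -e AB.
Qed.

Lemma rowsub_congruence m p n (h : 'I_p -> 'I_m) (V : 'M[C]_(m, n)) (A : 'M_n) :
  rowsub h V *m A *m (rowsub h V)^t* = mxsub h h (V *m A *m V^t*).
Proof.
apply/matrixP=> i j; rewrite [RHS]mxE !mxE; apply: eq_bigr => k _.
by rewrite !mxE; congr (_ * _); apply: eq_bigr => l _; rewrite !mxE.
Qed.

Lemma mxrank_diag n (d : 'rV[C]_n) :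
  \rank (diag_mx d) = (\sum_i (d 0%R i != 0%R))%N.
Proof.
elim: n d => [|n IHn] d; first by rewrite big_ord0 flatmx0 mxrank0.
have := rank_diag_block_mx (diag_mx (lsubmx (d : 'rV_(1 + n))))
  (diag_mx (rsubmx (d : 'rV_(1 + n)))).
rewrite -diag_mx_row hsubmxK => ->; rewrite IHn big_ord_recl.
congr (_ + _)%N.
  rewrite rank_rV; congr (nat_of_bool (~~ _)).
  apply/eqP/eqP => [/matrixP/(_ 0 0)|e].
    by rewrite !mxE mulr1n => h; rewrite -[RHS]h; congr (d _ _); apply: val_inj.
  apply/matrixP=> i j; rewrite !ord1 !mxE mulr1n -[RHS]e; congr (d _ _).
  exact: val_inj.
apply: eq_bigr => i _; rewrite !mxE; congr (nat_of_bool (d _ _ != 0)).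
exact: val_inj.
Qed.

(** For square [V] the rows are [W]-orthonormal eigenvectors of the pencil [H - x W], with
    eigenvalues [d]. Rectangular [V] is allowed, so that subfamilies of eigenvectors and
    compressions to a subspace are covered as well. *)
Definition resolves m n (H W : 'M[C]_n) (V : 'M_(m, n)) (d : 'rV_m) :=
  V *m W *m V^t* = 1%:M /\ V *m H *m V^t* = diag_mx d.

Lemma resolves_rowsub m p n (H W : 'M[C]_n) (V : 'M_(m, n)) (d : 'rV_m)
    (h : 'I_p -> 'I_m) :
  injective h -> resolves H W V d ->
  resolves H W (rowsub h V) (\row_i d 0 (h i)).
Proof.
move=> hI [VW VH]; split; rewrite rowsub_congruence ?VW ?VH.
  by apply/matrixP=> i j; rewrite !mxE (inj_eq hI).
by apply/matrixP=> i j; rewrite !mxE (inj_eq hI).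
Qed.

Lemma resolves_shift m n (H W : 'M[C]_n) (V : 'M_(m, n)) (d : 'rV_m) x :
  resolves H W V d ->
  V *m (H - x *: W) *m V^t* = diag_mx (\row_i (d 0 i - x)).
Proof.
case=> VW VH; rewrite mulmxBr mulmxBl -scalemxAr -scalemxAl VW VH.
by apply/matrixP=> i j; rewrite !mxE; case: eqP => [->|];
  rewrite ?mulr1 ?mulr0 ?subr0 ?mulr1n ?mulr0n.
Qed.

(** Congruence by [V] diagonalizes [H - x W], and taking determinants in [V W V^* = 1] removes the
    factors coming from [V]. *)
Lemma resolves_det n (H W V : 'M[C]_n) (d : 'rV_n) x : resolves H W V d ->
  \det (H - x *: W) = \det W * \prod_i (d 0 i - x).
Proof.
move=> res; have E := resolves_shift x res; case: res => VW _.
have e : \det V * \det W * \det (V^t*) = 1 by rewrite -!det_mulmx VW det1.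
have <- : \det (V *m (H - x *: W) *m V^t*) = \prod_i (d 0 i - x).
  by rewrite E det_diag; apply: eq_bigr => i _; rewrite mxE.
by rewrite !det_mulmx !mulrA [\det W * _]mulrC mulrAC e mul1r.
Qed.

(** Congruence by the invertible [V] preserves the rank, so the nullity is the number of zeros on
    the diagonal. This links the diagonal [d] with multiplicities. *)
Lemma resolves_ker n (H W V : 'M[C]_n) (d : 'rV_n) x : resolves H W V d ->
  \rank (kermx (H - x *: W)^T) = (\sum_i (d 0%R i == x))%N.
Proof.
move=> res; have E := resolves_shift x res; case: res => VW _.
have Vu : V \in unitmx by move: VW; rewrite -mulmxA => /mulmx1_unit[].
have Vu' : V^t* \in unitmx by move: VW => /mulmx1_unit[].
have -> : \rank (kermx (H - x *: W)^T) = (n - \rank (H - x *: W)%R)%N.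
  by rewrite mxrank_ker mxrank_tr.
have <- : \rank (V *m (H - x *: W) *m V^t*) = \rank (H - x *: W).
  by rewrite mxrankMfree ?row_free_unit // eqmxMfull ?row_full_unit.
rewrite E mxrank_diag.
rewrite -[X in (X - _)%N](card_ord n) -sum1_card.
apply/eqP; rewrite -(eqn_add2r (\sum_i ((\row_i0 (d 0 i0 - x)) 0 i != 0)%R)%N).
rewrite subnK; last by apply: leq_sum => i _; case: (_ != _).
rewrite -big_split /=; apply/eqP; apply: eq_bigr => i _.
by rewrite mxE subr_eq0; case: eqP.
Qed.

(** Rescaling by [E = W^(-1/2)] turns the pencil into the Hermitian matrix [E H E]; if the unitary
    [U] diagonalizes it, then [U E] resolves the pencil. *)
Lemma hermitian_resolution n (H : 'M[C]_n) (w : 'rV[C]_n) :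
  H^t* = H -> (forall i, 0 < w 0 i) ->
  exists (V : 'M_n) (d : 'rV_n), resolves H (diag_mx w) V d /\ d \is a realmx.
Proof.
move=> Hh w0.
pose E : 'M[C]_n := diag_mx (\row_i (sqrtC (w 0 i))^-1).
have Eh : E^t* = E.
  rewrite tr_diag_mx map_diag_mx; congr diag_mx; apply/rowP => i.
  rewrite !mxE; apply/CrealP; rewrite rpredV ger0_real // sqrtC_ge0 ltW //.
have EWE : E *m diag_mx w *m E = 1%:M.
  rewrite !mulmx_diag -diag_const_mx; congr diag_mx; apply/rowP => i.
  have nz : sqrtC (w 0 i) != 0 by rewrite sqrtC_eq0 gt_eqF.
  by rewrite !mxE -[X in _ * X * _](sqrtCK (w 0 i)) expr2 mulKf ?mulfV.
have H'h : E *m H *m E \is hermsymmx.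
  apply/is_hermitianmxP; rewrite expr0 scale1r.
  by rewrite [RHS]adjmxM [in RHS]adjmxM Hh Eh mulmxA.
pose U := spectralmx (E *m H *m E).
have Uu : U \is unitarymx by apply: spectral_unitarymx.
have UU : U *m U^t* = 1%:M by apply/unitarymxP.
exists (U *m E), (spectral_diag (E *m H *m E)); split; last first.
  exact: hermitian_spectral_diag_real.
have aux X : U *m E *m X *m (U *m E)^t* = U *m (E *m X *m E) *m U^t*.
  by rewrite adjmxM Eh !mulmxA.
split; rewrite aux; first by rewrite EWE mulmx1.
have e := elimT (@orthomx_spectralP _ _ _) (hermitian_normalmx H'h).
by rewrite {1}e -/U invmx_unitary // !mulmxA UU mul1mx -mulmxA UU mulmx1.
Qed.

End HermitianPencils.

(** * Sorted real spectra, min-max comparison and interlacing *)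

Section RealSpectrum.
Variable R : rcfType.
Local Notation C := R[i].
Local Notation "x %:C" := (real_complex R x) : ring_scope.

Definition realrow m (g : nat -> R) : 'rV[C]_m := \row_i (g i)%:C.

Lemma sorted_resolution n (H : 'M[C]_n) (w : nat -> R) :
  H^t* = H -> (forall i, (i < n)%N -> 0 < w i) ->
  exists (V : 'M_n) (s : seq R), [/\ size s = n, sorted <=%R s &
    resolves H (diag_mx (realrow n w)) V (realrow n (nth 0 s))].
Proof.
move=> Hh w0.
have [i|V [d [res dr]]] := hermitian_resolution (w := realrow n w) Hh.
  by rewrite mxE -[0]/(0%:C) ltcR w0.
pose t := [tuple complex.Re (d 0 i) | i < n].
(* Sorting the eigenvalues is matched by permuting the rows of [V] by [p]. *)
have /tuple_permP[p e] : perm_eq (sort <=%R t) t by rewrite perm_sort.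
exists (rowsub p V), (sort <=%R t); split.
- by rewrite size_sort size_tuple.
- by rewrite sort_sorted //; apply: le_total.
have -> : realrow n (nth 0 (sort <=%R t)) = \row_i d 0 (p i).
  apply/rowP => i; rewrite !mxE e.
  rewrite -tnth_nth !tnth_mktuple RRe_real //; exact: (mxOverP dr).
exact: resolves_rowsub perm_inj res.
Qed.

Lemma count_mem_nth (T : eqType) (x0 x : T) (s : seq T) :
  count_mem x s = (\sum_(i < size s) (nth x0 s i == x))%N.
Proof.
rewrite -sum1_count big_mkcond (big_nth x0) big_mkord.
by apply: eq_bigr => i _ /=; case: eqP.
Qed.

(** Courant-Fischer argument: on the top [m1 - j] vectors of [V1] the form of [A] is at least
    [s1_j], on the bottom [k + 1] vectors of [V2] the form of [B] is at most [s2_k], and the last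
    hypothesis makes these spans meet inside the kernel of [L]. Taking [d = 0] gives monotonicity,
    [d = 1] a shift by one index, and [m1] or [m2] below [n] Cauchy interlacing. *)
Lemma resolved_le n d m1 m2 (A B W : 'M[C]_n) (L : 'M[C]_(n, d))
    (V1 : 'M_(m1, n)) (V2 : 'M_(m2, n)) (s1 s2 : seq R) j k :
  size s1 = m1 -> size s2 = m2 -> sorted <=%R s1 -> sorted <=%R s2 ->
  resolves A W V1 (realrow m1 (nth 0 s1)) ->
  resolves B W V2 (realrow m2 (nth 0 s2)) ->
  (forall x : 'rV_n, x *m L = 0 ->
     (x *m A *m x^t*) 0 0 <= (x *m B *m x^t*) 0 0) ->
  (j < m1)%N -> (k < m2)%N -> (n + d + j <= m1 + k)%N ->
  s1`_j <= s2`_k.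
Proof.
move=> z1 z2 o1 o2 res1 res2 AB jm km dim.
have h1P (i : 'I_(m1 - j)) : (j + i < m1)%N by have := ltn_ord i; lia.
pose h1 i : 'I_m1 := Ordinal (h1P i).
have h1I : injective h1.
  by move=> a b /(congr1 val) /= /addnI /val_inj.
pose h2 : 'I_k.+1 -> 'I_m2 := widen_ord km.
have h2I : injective h2 by move=> a b /(congr1 val) /= /val_inj.
have [W1 A1] := resolves_rowsub h1I res1.
have [W2 B2] := resolves_rowsub h2I res2.
rewrite -lecR; apply: (rayleigh_le W1 A1 W2 B2 AB); last by lia.
- move=> i; rewrite !mxE lecR (sorted_leq_nth le_trans le_refl) //.
  + by rewrite inE z1.
  + by rewrite inE z1 /= h1P.
  + by rewrite /= leq_addr.
- move=> i; rewrite !mxE lecR (sorted_leq_nth le_trans le_refl) //.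
  + by rewrite inE z2 /=; apply: leq_trans (ltn_ord i) _.
  + by rewrite inE z2.
  + by rewrite /= -ltnS.
Qed.

(** At [x = nu_j] the right-hand product vanishes, so the left one is negative. By interlacing its
    [j] factors before index [j] are nonpositive and those after it nonnegative, hence the parity of
    [j] fixes the strict sign of [mu_j - nu_j]. *)
Lemma interlaced_roots_parity N (mu nu : nat -> R) :
  (forall i j, (i < j < N)%N -> mu i <= nu j /\ nu i <= mu j) ->
  (forall x, \prod_(i < N) (mu i - x) < \prod_(i < N) (nu i - x)) ->
  forall j, (j < N)%N -> if ~~ odd j then mu j < nu j else nu j < mu j.
Proof.
move=> inter cmp j jN; have := cmp (nu j).
rewrite (bigD1 (Ordinal jN) (F := fun i => nu i - _)) //= subrr mul0r.
rewrite -(big_mkord xpredT (fun i => mu i - nu j)).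
rewrite (big_cat_nat _ (n := j)) //= 1?ltnW // (big_ltn jN) mulrCA.
set X := \prod_(0 <= i < j) _; set Y := \prod_(j.+1 <= i < N) _.
have Y0 : 0 <= Y.
  rewrite /Y big_nat_cond; apply: prodr_ge0 => i.
  by rewrite andbT subr_ge0 => h; have [] := inter j i h.
have X0 : 0 <= (-1) ^+ j * X.
  rewrite /X big_mkord -[j in (-1) ^+ j]card_ord -prodrN.
  apply: prodr_ge0 => i _; rewrite opprB subr_ge0.
  by have [] := inter i j; rewrite ?ltn_ord.
rewrite -signr_odd in X0; case: (odd j) X0; rewrite ?expr0 ?expr1 /= => X0 h;
  rewrite ltNge; apply/negP => le.
  by have := mulr_ge0 (mulr_ge0 (_ : 0 <= nu j - mu j) X0) Y0; nra.
by have := mulr_ge0 (mulr_ge0 (_ : 0 <= mu j - nu j) X0) Y0; nra.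
Qed.

End RealSpectrum.

(** * Determinants under changes of one entry or of two opposite entries *)

Section CornerDeterminant.
Variable F : comNzRingType.

Lemma cofactor_row n (X Y : 'M[F]_n) i j :
  row' i X = row' i Y -> cofactor X i j = cofactor Y i j.
Proof.
move=> e; rewrite /cofactor; congr (_ * \det _).
apply/matrixP => k l; have := congr1 (fun Z : 'M_(_, _) => Z k (lift j l)) e.
by rewrite !mxE.
Qed.

(** In the expansion along row [i] the cofactors do not see that row, so the determinant is affine
    in the entry. *)
Lemma det_add_delta n (X : 'M[F]_n) a i j :
  \det (X + a *: delta_mx i j) = \det X + a * cofactor X i j.
Proof.
rewrite !(expand_det_row _ i) (eq_bigr (fun k => X i k * cofactor X i k +
  a * (k == j)%:R * cofactor X i k)) => [|k _]; last first.
  rewrite -(@cofactor_row _ X) ?mxE ?eqxx ?mulrDl //.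
  apply/matrixP=> k' l.
  by rewrite !mxE eq_sym (negPf (neq_lift _ _)) mulr0 addr0.
rewrite big_split /=; congr (_ + _); rewrite (bigD1 j) //= eqxx mulr1.
by rewrite big1 ?addr0 // => k /negPf ->; rewrite mulr0 mul0r.
Qed.

(** The determinant is affine in [a] and in [b] separately. The mixed coefficient is left
    unspecified: it cancels between two matrices with the same product [a * b]. *)
Lemma det_add_corners n (X : 'M[F]_n) i j : i != j ->
  exists c, forall a b,
    \det (X + a *: delta_mx i j + b *: delta_mx j i) =
    \det X + a * cofactor X i j + b * cofactor X j i + a * b * c.
Proof.
(* Once row [i] and column [j] are deleted, the entry [(j, i)] sits at position [(j', i')]. *)
move=> ij; have [i' Ei] : exists i', i = lift j i'.
  by case: (unliftP j i) ij => [i' ->|->]; [exists i'|rewrite eqxx].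
have [j' Ej] : exists j', j = lift i j'.
  by case: (unliftP i j) ij => [j' ->|->]; [exists j'|rewrite eqxx].
exists ((-1) ^+ (i + j) * cofactor (row' i (col' j X)) j' i') => a b.
rewrite addrAC det_add_delta det_add_delta.
suff -> : cofactor (X + b *: delta_mx j i) i j = cofactor X i j +
    b * ((-1) ^+ (i + j) * cofactor (row' i (col' j X)) j' i') by ring.
rewrite {1}/cofactor.
have -> : row' i (col' j (X + b *: delta_mx j i)) =
    row' i (col' j X) + b *: delta_mx j' i'.
  have Ek k : (lift i k == j) = (k == j').
    by rewrite [X in _ == X]Ej (inj_eq lift_inj).
  have El l : (lift j l == i) = (l == i').
    by rewrite [X in _ == X]Ei (inj_eq lift_inj).
  by apply/matrixP=> k l; rewrite !mxE Ek El.
by rewrite det_add_delta mulrDr [_ * (b * _)]mulrCA.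
Qed.
End CornerDeterminant.

(** * Jacobi matrices with corner entries and their dependence on the phase *)

Section PeriodicJacobi.
Variables (R : realType) (n : nat) (f q w : nat -> R).
Local Notation C := R[i].
Local Notation "x %:C" := (real_complex R x) : ring_scope.

(* Row [i] is the difference equation at index [i.+1], with the terms in [y_0]
   and [y_{n+2}] dropped. *)
Definition jacobi : 'M[C]_n.+1 := \matrix_(i, j)
  ((f i.+1 + f i + q i.+1)%:C * (i == j)%:R
   - (f i.+1)%:C * (j == i.+1 :> nat)%:R - (f i)%:C * (i == j.+1 :> nat)%:R).

Definition diag_jacobi (c0 cn : R) : 'M[C]_n.+1 :=
  jacobi + c0%:C *: delta_mx 0 0 + cn%:C *: delta_mx ord_max ord_max.

(* The boundary condition enters as [f_0 y_0 = z^* y_{n+1} - c0 y_1] and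
   [f_{n+1} y_{n+2} = z y_1 - cn y_{n+1}]. *)
Definition per_jacobi (c0 cn : R) (z : C) : 'M[C]_n.+1 :=
  diag_jacobi c0 cn + (- z) *: delta_mx ord_max 0
    + (- z^*) *: delta_mx 0 ord_max.

Definition weight : 'M[C]_n.+1 := diag_mx (realrow n.+1 (fun i => w i.+1)).

Lemma diag_jacobi_tr c0 cn : (diag_jacobi c0 cn)^T = diag_jacobi c0 cn.
Proof.
apply/matrixP=> i j; rewrite !mxE; rewrite (eq_sym j i).
rewrite [(j == 0) && _]andbC [(j == ord_max) && _]andbC; congr (_ + _ + _).
have [->|ne] := eqVneq i j.
  by rewrite -!addrA; congr (_ + _); rewrite addrC.
rewrite !mulr0 !sub0r addrC; congr (- _ - _).
  by have [->|] := eqVneq (nat_of_ord j) i.+1; rewrite ?mulr0 ?mulr1.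
by have [->|] := eqVneq (nat_of_ord i) j.+1; rewrite ?mulr0 ?mulr1.
Qed.

Lemma per_jacobi_herm c0 cn z : (per_jacobi c0 cn z)^t* = per_jacobi c0 cn z.
Proof.
have real : (diag_jacobi c0 cn) ^ Num.conj = diag_jacobi c0 cn.
  apply/matrixP=> i j; rewrite !mxE; apply/CrealP.
  have cr (x : R) : x%:C \is Num.real by rewrite complex_real.
  have nr (k : nat) : (k%:R : C) \is Num.real by apply: realn.
  by rewrite !(rpredD, rpredN, rpredM).
rewrite /per_jacobi; move: (diag_jacobi c0 cn) (diag_jacobi_tr c0 cn) real.
move=> D trD real; rewrite !linearD !linearZ /= !trmx_delta trD !map_mxD.
rewrite real !map_mxZ /= !map_delta_mx !rmorphN /= conjCK.
by rewrite addrAC.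
Qed.

(** For equal moduli the term in [z z^*] cancels, and the terms linear in the corners remain.
    [0 < n] keeps the two corners off the diagonal. *)
Lemma per_jacobi_det c0 cn (x z z' : C) : (0 < n)%N -> z * z^* = z' * z'^* ->
  \det (per_jacobi c0 cn z - x *: weight)
    - \det (per_jacobi c0 cn z' - x *: weight) =
  (\prod_(i < n) f i.+1)%:C * ((z' + z'^*) - (z + z^*)).
Proof.
move=> n0 ezz.
pose X := diag_jacobi c0 cn - x *: weight.
have ne : (ord_max : 'I_n.+1) != 0 by rewrite -val_eqE /= -lt0n.
have perE y : per_jacobi c0 cn y - x *: weight =
    X + (- y) *: delta_mx ord_max 0 + (- y^*) *: delta_mx 0 ord_max.
  have add4AC (V : zmodType) (a b c d : V) : a + b + c - d = a - d + b + c.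
    by rewrite addrAC; congr (_ + _); rewrite addrAC.
  exact: add4AC.
have [c Ec] := det_add_corners X ne.
have Xtr : X^T = X.
  by rewrite /X linearB /= linearZ /= diag_jacobi_tr tr_diag_mx.
have up (i j : 'I_n.+1) : (i < j)%N ->
    X i j = - ((f i.+1)%:C * (j == i.+1 :> nat)%:R).
  move=> ij; rewrite !mxE -!val_eqE /=.
  rewrite (ltn_eqF ij) (ltn_eqF (leq_trans ij (leqnSn _))).
  rewrite [nat_of_ord j == 0%N]gtn_eqF ?(leq_trans _ ij) // andbF.
  have -> : (nat_of_ord i == n) && (nat_of_ord j == n) = false.
    by apply/negP => /andP[/eqP ei /eqP ej]; rewrite ei ej ltnn in ij.
  by rewrite !mulr0 !subr0 !addr0 sub0r.
(* Deleting the last row and first column leaves a triangular matrix with diagonal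
   [- f_1, ..., - f_n]; the cofactor sign absorbs the minus signs. *)
have cofE : cofactor X ord_max 0 = (\prod_(i < n) f i.+1)%:C.
  rewrite /cofactor addn0 det_trig.
    rewrite rmorph_prod /= -[n in (-1) ^+ n]card_ord -prodrN.
    apply: eq_bigr => i _; rewrite 2!mxE up lift_max lift0 //.
    by rewrite eqxx mulr1 opprK.
  apply/is_trig_mxP => i j ij; rewrite 2!mxE up lift_max lift0.
    by rewrite eqSS gtn_eqF // mulr0 oppr0.
  by rewrite ltnS ltnW.
have cofE' : cofactor X 0 ord_max = (\prod_(i < n) f i.+1)%:C.
  by rewrite -cofE -cofactor_tr Xtr.
have alg (D p c' a b a' b' : C) :
    (D + - a * p + - b * p + c') - (D + - a' * p + - b' * p + c') =
    p * ((a' + b') - (a + b)) by ring.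
have E (y t : C) : y * y^* = t -> \det (per_jacobi c0 cn y - x *: weight) =
    \det X + - y * (\prod_(i < n) f i.+1)%:C
      + - y^* * (\prod_(i < n) f i.+1)%:C + t * c.
  by move=> <-; rewrite perE Ec cofE cofE' [- y * - y^*]mulrNN.
exact: etrans (congr2 (fun a b => a - b) (E z _ ezz) (E z' _ erefl))
  (alg _ _ _ _ _ _ _).
Qed.

End PeriodicJacobi.

(** * Reduction of the boundary problems to pencils: equality of multiplicities *)

Lemma rank_ker_iso (F : fieldType) m m' n n' (A : 'M[F]_(m, m'))
    (B : 'M[F]_(n, n')) (P : 'M[F]_(m, n)) :
  (forall u : 'rV_m, u *m A = 0 -> u *m P *m B = 0) ->
  (forall u : 'rV_m, u *m A = 0 -> u *m P = 0 -> u = 0) ->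
  (forall v : 'rV_n, v *m B = 0 ->
     exists2 u : 'rV_m, u *m A = 0 & u *m P = v) ->
  \rank (kermx A) = \rank (kermx B).
Proof.
move=> sub inj surj; apply/eqP; rewrite eqn_leq; apply/andP; split.
  (* Injectivity of [P] on the kernel of [A] means that the kernels of [A] and [P] meet trivially,
     so multiplying by [P] loses no rank. *)
  have <- : \rank (kermx A *m P) = \rank (kermx A).
    apply/mxrank_injP/eqP/row_matrixP => i; rewrite row0.
    have := row_sub i (kermx A :&: kermx P)%MS.
    rewrite sub_capmx => /andP[/sub_kermxP h1 /sub_kermxP h2]; exact: inj.
  apply/mxrankS/row_subP => i; apply/sub_kermxP; rewrite row_mul; apply: sub.
  by apply/sub_kermxP; apply: row_sub.
apply: leq_trans (mxrankM_maxl _ P); apply/mxrankS/row_subP => i.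
have /sub_kermxP/surj[u /sub_kermxP uA <-] := row_sub i (kermx B).
exact: submxMr.
Qed.

Section Kernel.
Variables (R : realType) (n : nat) (f q w : nat -> R).
Hypothesis f0 : forall i, (i <= n.+1)%N -> f i != 0.
Local Notation C := R[i].
Local Notation "x %:C" := (real_complex R x) : ring_scope.

Lemma sl_sys_linear A B lam (a : C) (y z : 'I_n.+3 -> C) i :
  sl_sys f q w A B lam (fun k => a * y k + z k) i =
  a * sl_sys f q w A B lam y i + sl_sys f q w A B lam z i.
Proof. by rewrite /sl_sys; case: ifP => _; [|case: ifP => _]; ring. Qed.

Lemma sl_mxE A B lam (u : 'rV[C]_n.+3) i :
  (u *m (sl_mx n.+1 f q w A B lam)^T) 0 i = sl_sys f q w A B lam (u 0) i.
Proof.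
rewrite mxE.
have e (r : seq 'I_n.+3) :
    sl_sys f q w A B lam (fun k => \sum_(l <- r) u 0 l * (k == l)%:R) i =
    \sum_(l <- r) u 0 l * sl_sys f q w A B lam (fun k => (k == l)%:R) i.
  elim: r => [|l r IHr].
    rewrite big_nil (_ : (fun _ => _) = fun k => 0 * 0 + 0); last first.
      by apply/funext => k; rewrite big_nil mulr0 addr0.
    rewrite sl_sys_linear mul0r add0r.
    rewrite /sl_sys; case: ifP => _; [|case: ifP => _]; ring.
  rewrite big_cons -IHr -sl_sys_linear; congr sl_sys.
  by apply/funext => k; rewrite big_cons.
transitivity (sl_sys f q w A B lam
    (fun k => \sum_l u 0 l * (k == l)%:R) i).
  by rewrite e; apply: eq_bigr => l _; rewrite !mxE.
congr sl_sys; apply/funext => k.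
rewrite (bigD1 k) //= eqxx mulr1 big1 ?addr0 // => l.
by rewrite eq_sym => /negPf ->; rewrite mulr0.
Qed.

Definition bc (A B : 'M[C]_2) (Y0 Y1 YN YN1 : C) := forall r : 'I_2,
  A r 0 * Y0 + A r 1 * ((f 0%N)%:C * (Y1 - Y0)) + B r 0 * YN
    + B r 1 * ((f n.+1)%:C * (YN1 - YN)) = 0.

(** The index is shifted as in [jacobi]: [i] stands for the difference equation at [i.+1]. Sequences
    on [nat] avoid the casts of [sl_sys]. *)
Definition diffeq (lam : R) (Y : nat -> C) (i : nat) :=
  - ((f i.+1)%:C * (Y i.+2 - Y i.+1) - (f i)%:C * (Y i.+1 - Y i))
  + (q i.+1)%:C * Y i.+1 - lam%:C * (w i.+1)%:C * Y i.+1.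

Lemma sl_kerP A B lam (Y : nat -> C) :
  (\row_(k < n.+3) Y k) *m (sl_mx n.+1 f q w A B lam)^T = 0 <->
  bc A B (Y 0%N) (Y 1%N) (Y n.+1) (Y n.+2) /\
  forall i, (i < n.+1)%N -> diffeq lam Y i = 0.
Proof.
have YE k : (k < n.+3)%N -> (\row_(k < n.+3) Y k) 0 (inord k) = Y k.
  by move=> kn; rewrite mxE inordK.
split.
  move=> e; have sys i : sl_sys f q w A B lam ((\row_(k < n.+3) Y k) 0) i = 0.
    by rewrite -sl_mxE e mxE.
  split.
    move=> r; case: (unliftP 0 r) => [r'|] ->.
      have := sys ord_max; rewrite /sl_sys /= eqxx !YE //; rewrite ord1.
      by rewrite (_ : lift 0 0 = 1) //; apply: val_inj.
    by have := sys 0; rewrite /sl_sys /= !YE.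
  move=> i iN; have := sys (inord i.+1); rewrite /sl_sys /= inordK; last by lia.
  by rewrite /= eqSS ltn_eqF // !YE //; lia.
case=> b d; apply/rowP => i; rewrite sl_mxE mxE /sl_sys.
case: ifP => [_|/negbT i0]; first by rewrite !YE //; apply: (b 0).
case: ifP => [_|/negbT iN]; first by rewrite !YE //; apply: (b 1).
have := ltn_ord i; rewrite ltnS leq_eqVlt (negPf iN) /= ltnS => {}iN.
move: i0 iN; rewrite /=; case: (nat_of_ord i) => // k _ kn.
by rewrite /= !YE; [apply: d|lia..].
Qed.

Lemma sum_delta (F : comNzRingType) m (g : nat -> F) k :
  \sum_(j < m) g j * (j == k :> nat)%:R = if (k < m)%N then g k else 0.
Proof.
case: ltnP => km.
  rewrite (bigD1 (Ordinal km)) //= eqxx mulr1 big1 ?addr0 // => j.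
  by rewrite -val_eqE /= => /negPf ->; rewrite mulr0.
by rewrite big1 // => j _; rewrite ltn_eqF ?mulr0 // (leq_trans _ km).
Qed.

Lemma per_jacobiE c0 cn z lam (V : nat -> C) (i : 'I_n.+1) :
  ((\row_(k < n.+1) V k) *m
     (per_jacobi n f q c0 cn z - lam%:C *: weight n w)^T) 0 i =
  ((f i.+1)%:C + (f i)%:C + (q i.+1)%:C) * V i - lam%:C * (w i.+1)%:C * V i
  - (f i.+1)%:C * (if (i.+1 < n.+1)%N then V i.+1 else 0)
  - (f i)%:C * (if (0 < i)%N then V i.-1 else 0)
  + (i == 0%N :> nat)%:R * (c0%:C * V 0%N - z^* * V n)
  + (i == n :> nat)%:R * (cn%:C * V n - z * V 0%N).
Proof.
have andR (b1 b2 : bool) : ((b1 && b2)%:R : C) = b1%:R * b2%:R.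
  by case: b1; rewrite ?mul1r ?mul0r.
rewrite mxE.
transitivity (\sum_(j < n.+1) (
   V j * (j == i :> nat)%:R *
     ((f i.+1)%:C + (f i)%:C + (q i.+1)%:C - lam%:C * (w i.+1)%:C)
   - (f i.+1)%:C * (V j * (j == i.+1 :> nat)%:R)
   - (f i)%:C * (V j * (j.+1 == i :> nat)%:R)
   + (i == 0%N :> nat)%:R * (c0%:C * (V j * (j == 0%N :> nat)%:R)
       - z^* * (V j * (j == n :> nat)%:R))
   + (i == n :> nat)%:R * (cn%:C * (V j * (j == n :> nat)%:R)
       - z * (V j * (j == 0%N :> nat)%:R)))).
  apply: eq_bigr => j _; rewrite !mxE -!val_eqE /= !rmorphD /=.
  rewrite !andR (eq_sym (nat_of_ord j) i) (eq_sym j.+1 i).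
  rewrite -(mulr_natr _ (nat_of_ord i == j)); ring.
have pred_delta : \sum_(j < n.+1) V j * (j.+1 == i :> nat)%:R =
    if (0 < i)%N then V i.-1 else 0.
  case: i => -[|k] kn /=; first by rewrite big1 // => j _; rewrite mulr0.
  by under eq_bigr => j _ do rewrite eqSS; rewrite sum_delta ltnW.
rewrite !big_split /= -mulr_suml !sumrN -!mulr_sumr !big_split /= !sumrN.
rewrite -!mulr_sumr pred_delta !sum_delta ltn_ord ltnSn /=.
by congr (_ - _ - _ + _ + _); ring.
Qed.

(** The boundary relations restore the terms in [y_0] and [y_{n+2}] missing from the first and last
    rows. The left relation is asked for only in row 0, so that it can be dispensed with after
    truncation. *)
Lemma per_jacobi_diffeq c0 cn z lam (Y : nat -> C) (i : 'I_n.+1) :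
  (i = 0 -> (f 0%N)%:C * Y 0%N = z^* * Y n.+1 - c0%:C * Y 1%N) ->
  (f n.+1)%:C * Y n.+2 = z * Y 1%N - cn%:C * Y n.+1 ->
  ((\row_(k < n.+1) Y k.+1) *m
     (per_jacobi n f q c0 cn z - lam%:C *: weight n w)^T) 0 i = diffeq lam Y i.
Proof.
move=> hl hr; rewrite (per_jacobiE _ _ _ _ (fun k => Y k.+1)) /diffeq.
have e1 : (f i)%:C * (if (0 < i)%N then Y i.-1.+1 else 0)
    - (i == 0%N :> nat)%:R * (c0%:C * Y 1%N - z^* * Y n.+1) = (f i)%:C * Y i.
  have [i0|] := posnP i; last first.
    by case: (nat_of_ord i) => // k _; rewrite mul0r subr0.
  by rewrite i0 mulr0 mul1r sub0r opprB hl //; apply: val_inj.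
have e2 : (f i.+1)%:C * (if (i.+1 < n.+1)%N then Y i.+2 else 0)
    - (i == n :> nat)%:R * (cn%:C * Y n.+1 - z * Y 1%N) = (f i.+1)%:C * Y i.+2.
  have := ltn_ord i; rewrite !ltnS leq_eqVlt.
  case: eqP => [->|_ /= ->]; last by rewrite mul0r subr0.
  by rewrite ltnn mulr0 mul1r sub0r opprB hr.
move: e1 e2.
move: (if (0 < i)%N then _ else _) (if (i.+1 < n.+1)%N then _ else _).
move=> t1 t2; rewrite !mulrBr => /eqP; rewrite subr_eq => /eqP e1.
move=> /eqP; rewrite subr_eq => /eqP e2; rewrite e1 e2; ring.
Qed.

Lemma row_natP m (u : 'rV[C]_m) : exists Y : nat -> C, u = \row_(k < m) Y k.
Proof.
case: m u => [|m] u; first by exists (fun=> 0); apply/rowP => -[].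
by exists (fun k => u 0 (inord k)); apply/rowP => k; rewrite mxE inord_val.
Qed.

(** Right multiplication cuts out the window of length [m] starting at index [p]: the interior
    values for [p = 1], those without [y_1] for [p = 2]. *)
Definition shift_mx m p : 'M[C]_(n.+3, m) :=
  \matrix_(k, i) (k == i + p :> nat)%N%:R.

Lemma shift_mxE m p (Y : nat -> C) : (m + p <= n.+3)%N ->
  (\row_(k < n.+3) Y k) *m shift_mx m p = \row_(i < m) Y (i + p)%N.
Proof.
move=> mp; apply/rowP=> i; rewrite !mxE.
under eq_bigr => k _ do rewrite !mxE.
rewrite sum_delta (leq_trans _ mp) //; have := ltn_ord i; lia.
Qed.

(** Since [f_0] and [f_N] are nonzero, the boundary relations determine [y_0] and [y_{N+1}] from the
    interior values, so restriction is an isomorphism of solution spaces. *)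
Lemma sl_mult_per A B c0 cn z lam :
  (forall Y0 Y1 YN YN1, bc A B Y0 Y1 YN YN1 <->
     (f 0%N)%:C * Y0 = z^* * YN - c0%:C * Y1 /\
     (f n.+1)%:C * YN1 = z * Y1 - cn%:C * YN) ->
  sl_mult n.+1 f q w A B lam =
  \rank (kermx (per_jacobi n f q c0 cn z - lam%:C *: weight n w)^T).
Proof.
move=> bcP; apply: (@rank_ker_iso _ _ _ _ _ _ _ (shift_mx n.+1 1)).
- move=> u; have [Y ->] := row_natP u; move=> /sl_kerP [/bcP[h1 h2] d].
  rewrite shift_mxE ?addn1 //; apply/rowP => i.
  rewrite (_ : \row_i0 _ = \row_(k < n.+1) Y k.+1); last first.
    by apply/rowP => k; rewrite !mxE addn1.
  by rewrite per_jacobi_diffeq // mxE d.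
- move=> u; have [Y ->] := row_natP u; move=> /sl_kerP [/bcP[h1 h2] d].
  rewrite shift_mxE ?addn1 // => /rowP e.
  have e' k : (k < n.+1)%N -> Y k.+1 = 0.
    by move=> kn; have := e (Ordinal kn); rewrite !mxE addn1.
  have fnz k : (k <= n.+1)%N -> (f k)%:C != 0.
    by move=> kn; rewrite fmorph_eq0 f0.
  apply/rowP => k; rewrite !mxE; have := ltn_ord k.
  case: (nat_of_ord k) => [_|k' kn].
    apply: (mulfI (fnz 0%N isT)).
    by rewrite h1 !e' // !mulr0 subrr.
  have [k'n|] := ltnP k' n.+1; first exact: e'.
  move=> nk; have -> : k' = n.+1 by lia.
  apply: (mulfI (fnz n.+1 _)) => //.
  by rewrite h2 !e' // !mulr0 subrr.
- move=> v; have [V ->] := row_natP v; move=> vB.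
  pose Y k := if k is k'.+1 then
      if (k' < n.+1)%N then V k' else (z * V 0%N - cn%:C * V n) / (f n.+1)%:C
    else (z^* * V n - c0%:C * V 0%N) / (f 0%N)%:C.
  have fnz k : (k <= n.+1)%N -> (f k)%:C != 0.
    by move=> kn; rewrite fmorph_eq0 f0.
  have h1 : (f 0%N)%:C * Y 0%N = z^* * Y n.+1 - c0%:C * Y 1%N.
    by rewrite /= ltnSn mulrC divfK ?fnz.
  have h2 : (f n.+1)%:C * Y n.+2 = z * Y 1%N - cn%:C * Y n.+1.
    by rewrite /= ltnSn ltnn mulrC divfK ?fnz.
  have YV : \row_(i < n.+1) Y i.+1 = \row_(i < n.+1) V i.
    by apply/rowP=> i; rewrite !mxE /= ltn_ord.
  exists (\row_k Y k); last first.
    rewrite shift_mxE ?addn1 // -YV; apply/rowP=> i.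
    by rewrite !mxE addn1.
  apply/sl_kerP; split; first exact/bcP.
  move=> i iN; rewrite -(@per_jacobi_diffeq c0 cn z lam Y (Ordinal iN)) //.
  by rewrite YV vB mxE.
Qed.

Lemma mulmx_lift_tr (X : 'M[C]_n.+1) (V : nat -> C) (i : 'I_n) : V 0%N = 0 ->
  ((\row_(k < n) V k.+1) *m (mxsub (lift 0) (lift 0) X)^T) 0 i =
  ((\row_(k < n.+1) V k) *m X^T) 0 (lift 0 i).
Proof.
move=> V0; rewrite !mxE big_ord_recl !mxE V0 mul0r add0r.
by apply: eq_bigr => k _; rewrite !mxE.
Qed.

(** With [y_1 = 0] the first equation merely determines [y_0]; the others form the compression to
    [y_1 = 0]. The parameters [c0] and [z] live in row or column 0 and stay free, to be matched with
    a coupled problem; [- f n.+1] encodes [y_{N+1} = y_N]. *)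
Lemma sl_mult_trunc A B c0 z lam : (0 < n)%N ->
  (forall Y0 Y1 YN YN1, bc A B Y0 Y1 YN YN1 <-> Y1 = 0 /\ YN1 = YN) ->
  sl_mult n.+1 f q w A B lam =
  \rank (kermx (mxsub (lift 0) (lift 0)
    (per_jacobi n f q c0 (- f n.+1) z - lam%:C *: weight n w))^T).
Proof.
move=> n0 bcP.
have fz : (f 0%N)%:C != 0 by rewrite fmorph_eq0 f0.
have hr Y : Y 1%N = 0 -> Y n.+2 = Y n.+1 ->
    (f n.+1)%:C * Y n.+2 = z * Y 1%N - (- f n.+1)%:C * Y n.+1.
  by move=> -> ->; rewrite mulr0 sub0r rmorphN mulNr opprK.
have d0E Y : Y 1%N = 0 ->
    diffeq lam Y 0 = - ((f 1%N)%:C * Y 2%N + (f 0%N)%:C * Y 0%N).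
  by rewrite /diffeq => ->; ring.
apply: (@rank_ker_iso _ _ _ _ _ _ _ (shift_mx n 2)).
- move=> u; have [Y ->] := row_natP u; move=> /sl_kerP [/bcP[h1 h2] d].
  rewrite shift_mxE ?addn2 //; apply/rowP => i.
  rewrite (_ : \row_i0 _ = \row_(k < n) Y k.+2); last first.
    by apply/rowP => k; rewrite !mxE addn2.
  rewrite (mulmx_lift_tr _ (V := fun k => Y k.+1)) //.
  by rewrite per_jacobi_diffeq ?hr // mxE d.
- move=> u; have [Y ->] := row_natP u; move=> /sl_kerP [/bcP[h1 h2] d].
  rewrite shift_mxE ?addn2 // => /rowP e.
  have e' k : (k < n)%N -> Y k.+2 = 0.
    by move=> kn; have := e (Ordinal kn); rewrite !mxE addn2.
  apply/rowP => k; rewrite !mxE; have := ltn_ord k.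
  case: (nat_of_ord k) => [_|[|k']] //.
    have /eqP := d 0%N isT; rewrite d0E // e' // mulr0 add0r oppr_eq0.
    by rewrite mulf_eq0 (negPf fz) => /eqP.
  rewrite !ltnS leq_eqVlt => /orP[/eqP->|]; last exact: e'.
  by rewrite h2 -[n]prednK // e' // prednK.
- move=> v; have [V ->] := row_natP v; move=> vB.
  (* [Y 0] solves the first equation, and the final branch repeats the last entry to get
     [y_{N+1} = y_N]. *)
  pose Y k := match k with
    | 0%N => - ((f 1%N)%:C * V 0%N) / (f 0%N)%:C
    | 1%N => 0
    | k'.+2 => if (k' < n)%N then V k' else V n.-1
    end.
  have Y2 : Y n.+2 = Y n.+1.
    by rewrite /= ltnn; case: (n) n0 => // m _; rewrite ltnSn.
  have YV : \row_(i < n) Y i.+2 = \row_(i < n) V i.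
    by apply/rowP=> i; rewrite !mxE /= ltn_ord.
  exists (\row_k Y k); last first.
    by rewrite shift_mxE ?addn2 // -YV; apply/rowP=> i; rewrite !mxE addn2.
  apply/sl_kerP; split; first exact/bcP.
  case=> [_|i iN].
    by rewrite d0E //= n0 mulrCA mulfV // mulr1 subrr oppr0.
  pose i' := Ordinal (iN : (i < n)%N).
  rewrite -(@per_jacobi_diffeq c0 (- f n.+1) z lam Y (lift 0 i')) ?hr //.
  rewrite -(mulmx_lift_tr _ (V := fun k => Y k.+1)) //.
  by rewrite YV vB mxE.
Qed.

End Kernel.

(** * Algebra of the boundary conditions *)

Lemma det_mx22 (F : comNzRingType) (M : 'M[F]_2) :
  \det M = M 0 0 * M 1 1 - M 0 1 * M 1 0.
Proof.
rewrite (expand_det_row _ 0) !big_ord_recl big_ord0 /cofactor !det_mx11 !mxE.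
rewrite addr0 expr0 mul1r expr1 mulN1r mulrN.
by congr (M _ _ * M _ _ - M _ _ * M _ _); apply: val_inj.
Qed.

Section BoundaryAlgebra.
Variables (F : fieldType) (g0 gN m00 m01 m10 m11 : F).
Let a := m00 - g0 * m01.
Let b := g0 * m11 - m10.

(** Here [u] plays the phase and [v] its conjugate. The determinant condition becomes
    [a * m11 + b * m01 = 1], which eliminates [m11]; what remains is a rational identity. *)
Lemma coupled_bcP (u v Y0 Y1 YN YN1 : F) :
  m00 * m11 - m01 * m10 = 1 -> u * v = 1 -> a != 0 -> g0 != 0 ->
  (u * m00 * Y0 + u * m01 * (g0 * (Y1 - Y0)) - YN = 0 /\
   u * m10 * Y0 + u * m11 * (g0 * (Y1 - Y0)) - gN * (YN1 - YN) = 0) <->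
  (g0 * Y0 = g0 / a * v * YN - g0 ^+ 2 * m01 / a * Y1 /\
   gN * YN1 = g0 / a * u * Y1 - (b / a - gN) * YN).
Proof.
move=> detM uv a0 g00.
have u0 : u != 0.
  by apply/eqP => u0; move/eqP: uv; rewrite u0 mul0r eq_sym oner_eq0.
have vE : v = u^-1 by apply: (mulfI u0); rewrite uv mulfV.
have m00E : m00 = a + g0 * m01 by rewrite /a; ring.
have m10E : m10 = g0 * m11 - b by rewrite /b; ring.
have abE : a * m11 + b * m01 = 1 by rewrite -detM /a /b; ring.
clearbody a b; rewrite vE m00E m10E {vE uv v detM}.
have m11E : m11 = (1 - b * m01) / a by rewrite -abE; field.
rewrite m11E; split => -[e1 e2].
  have EN : YN = u * (a * Y0 + g0 * m01 * Y1).
    by apply/eqP; rewrite -subr_eq0 -oppr_eq0 -e1; apply/eqP; ring.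
  have EN1 : gN * YN1 =
      gN * YN - b * u * Y0 + u * ((1 - b * m01) / a) * g0 * Y1.
    by apply/eqP; rewrite -subr_eq0 -oppr_eq0 -e2; apply/eqP; ring.
  split; first by rewrite EN; field; rewrite a0 u0.
  by rewrite EN1 EN; field.
have EY : Y0 = YN / (u * a) - g0 * m01 / a * Y1.
  by apply: (mulfI g00); rewrite e1; field; rewrite a0 u0.
split; first by rewrite EY; field; rewrite a0 u0.
by rewrite [gN * (_ - _)]mulrBr e2 EY; field; rewrite a0 u0.
Qed.

(** Conjugates enter as independent variables [Xc], [Yc], so completing the square, the source of
    the term [(b / a) |t|^2], is a rational identity. *)
Lemma coupled_form_sub (u v X Xc Y Yc : F) :
  m00 * m11 - m01 * m10 = 1 -> u * v = 1 -> a != 0 -> b != 0 ->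
  g0 ^+ 2 * m01 / a * (X * Xc) + (b / a - gN) * (Y * Yc)
    + - (g0 / a * u) * (Y * Xc) + - (g0 / a * v) * (X * Yc) =
  - (g0 ^+ 2 * m11 / b) * (X * Xc) + - gN * (Y * Yc)
    + b / a * ((u * Y - g0 / b * X) * (v * Yc - g0 / b * Xc)).
Proof.
move=> detM uv a0 b0.
have u0 : u != 0.
  by apply/eqP => u0; move/eqP: uv; rewrite u0 mul0r eq_sym oner_eq0.
have vE : v = u^-1 by apply: (mulfI u0); rewrite uv mulfV.
have abE : a * m11 + b * m01 = 1 by rewrite -detM /a /b; ring.
clearbody a b; have m11E : m11 = (1 - b * m01) / a by rewrite -abE; field.
by rewrite m11E vE; field; rewrite a0 b0 u0.
Qed.

End BoundaryAlgebra.

(** * Eigenvalue lists of the coupled and separated problems and their comparison *)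

Section Spectra.
Variables (R : realType) (n : nat) (f q w : nat -> R).
Hypothesis f_neq0 : forall i, (i <= n.+1)%N -> f i != 0.
Hypothesis w_gt0 : forall i, (1 <= i <= n.+1)%N -> 0 < w i.
Local Notation C := R[i].
Local Notation "x %:C" := (real_complex R x) : ring_scope.
Local Notation N := n.+1.

(** A sorted list is determined by its counts, so the choice in [eig_list] is forced. *)
Lemma eig_listE A B s : is_eig_list N f q w A B s -> eig_list N f q w A B = s.
Proof.
move=> es; apply: xget_unique => // t [ot ct]; case: es => os cs.
apply: (sorted_eq le_trans le_anti ot os).
by apply/allP => x _; apply/eqP; rewrite /= ct cs.
Qed.

Lemma per_eig_list A B c0 cn z :
  (forall Y0 Y1 YN YN1, bc n f A B Y0 Y1 YN YN1 <->
     (f 0%N)%:C * Y0 = z^* * YN - c0%:C * Y1 /\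
     (f n.+1)%:C * YN1 = z * Y1 - cn%:C * YN) ->
  exists V, let s := eig_list N f q w A B in
    [/\ size s = N, sorted <=%R s & resolves (per_jacobi n f q c0 cn z)
          (weight n w) V (realrow N (nth 0 s))].
Proof.
move=> bcP.
have [|V [s [sz os res]]] := sorted_resolution (w := fun i => w i.+1)
  (per_jacobi_herm n f q c0 cn z).
  by move=> i iN; apply: w_gt0.
exists V; rewrite (@eig_listE _ _ s) //; split=> // mu.
rewrite (sl_mult_per q w f_neq0 mu bcP) (resolves_ker _ res).
rewrite (count_mem_nth 0) sz.
by apply: eq_bigr => i _; rewrite mxE (inj_eq (@complexI R)).
Qed.

(** The eigenvectors of the compression are put back into dimension [N] by a zero first entry, so
    that they can be compared with those of the full pencil. *)
Lemma trunc_eig_list A B c0 z : (0 < n)%N ->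
  (forall Y0 Y1 YN YN1, bc n f A B Y0 Y1 YN YN1 <-> Y1 = 0 /\ YN1 = YN) ->
  exists V : 'M_(n, n.+1), let s := eig_list N f q w A B in
    [/\ size s = n, sorted <=%R s & resolves (per_jacobi n f q c0 (- f N) z)
          (weight n w) V (realrow n (nth 0 s))].
Proof.
move=> n0 bcP.
pose T (X : 'M[C]_n.+1) := mxsub (lift 0) (lift 0) X : 'M_n.
pose H := per_jacobi n f q c0 (- f N) z.
have Hh : H^t* = H := per_jacobi_herm n f q c0 (- f N) z.
have HT : (T H)^t* = T H.
  rewrite -[in RHS]Hh /T; move: H {Hh} => H.
  by apply/matrixP => i j; rewrite !mxE.
have [|V [s [sz os res]]] := sorted_resolution (w := fun i => w i.+2) HT.
  by move=> i iN; apply: w_gt0.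
have WT : T (weight n w) = diag_mx (realrow n (fun i => w i.+2)).
  by apply/matrixP=> i j; rewrite !mxE (inj_eq lift_inj) lift0.
have TE X : T X = rowsub (lift 0) 1%:M *m X *m (rowsub (lift 0) 1%:M)^t*.
  by rewrite rowsub_congruence mul1mx trmx1 map_mx1 mulmx1.
exists (V *m rowsub (lift 0) 1%:M); rewrite (@eig_listE _ _ s).
  case: res; rewrite -WT !TE => r1 r2.
  by split=> //; split; rewrite adjmxM !mulmxA -?r1 -?r2 !mulmxA.
split=> // mu.
rewrite (sl_mult_trunc q w f_neq0 c0 z mu n0 bcP) (count_mem_nth 0) sz.
rewrite (_ : mxsub _ _ _ =
    T H - mu%:C *: diag_mx (realrow n (fun i => w i.+2))).
  rewrite (resolves_ker _ res); apply: eq_bigr => i _.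
  by rewrite mxE (inj_eq (@complexI R)).
by rewrite -WT; apply/matrixP => i j; rewrite !mxE.
Qed.

Lemma per_jacobi_form c0 cn z (x : 'rV[C]_N) :
  (x *m per_jacobi n f q c0 cn z *m x^t*) 0 0 =
  (x *m jacobi n f q *m x^t*) 0 0 + c0%:C * (x 0 0 * (x 0 0)^*)
  + cn%:C * (x 0 ord_max * (x 0 ord_max)^*)
  + - z * (x 0 ord_max * (x 0 0)^*) + - z^* * (x 0 0 * (x 0 ord_max)^*).
Proof.
have dE i j : (x *m delta_mx i j *m x^t*) 0 0 = x 0 i * (x 0 j)^*.
  rewrite -(mul_delta_mx (0 : 'I_1) i j) mulmxA -colE -mulmxA -rowE.
  by rewrite mxE big_ord1 !mxE.
have dZ (t : C) i j : (x *m (t *: delta_mx i j) *m x^t*) 0 0 =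
    t * (x 0 i * (x 0 j)^*).
  by rewrite -scalemxAr -scalemxAl mxE dE.
have formD (P Q : 'M[C]_N) : (x *m (P + Q) *m x^t*) 0 0 =
    (x *m P *m x^t*) 0 0 + (x *m Q *m x^t*) 0 0.
  by rewrite mulmxDr mulmxDl mxE.
rewrite /per_jacobi /diag_jacobi; move: (jacobi n f q) => J; rewrite 4!formD.
by congr (_ + _ + _ + _ + _); apply: dZ.
Qed.

Section Coupled.
Variable M : 'M[R]_2.
Hypothesis detM : \det M = 1.
Let a := M 0 0 - f 0%N * M 0 1.
Let b := f 0%N * M 1 1 - M 1 0.
Hypothesis a_gt0 : 0 < a.
(** Coefficients of the solved condition [[u M | -I]], whose corner entry is [k * u]. For unimodular
    [u] only this entry varies, at constant modulus. *)
Let k := f 0%N / a.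
Let c0 := f 0%N ^+ 2 * M 0 1 / a.
Let cn := b / a - f N.

Let f0_neq0 : f 0%N != 0. Proof. exact: f_neq0. Qed.

Let det22 : M 0 0 * M 1 1 - M 0 1 * M 1 0 = 1.
Proof. by rewrite -detM det_mx22. Qed.

Lemma bc_coupled (u : C) Y0 Y1 YN YN1 : u * u^* = 1 ->
  bc n f (u *: cmx M) (- 1%:M) Y0 Y1 YN YN1 <->
  (f 0%N)%:C * Y0 = (k%:C * u)^* * YN - c0%:C * Y1 /\
  (f N)%:C * YN1 = k%:C * u * Y1 - cn%:C * YN.
Proof.
move=> uu.
have conjk : (k%:C * u)^* =
    (f 0%N)%:C / ((M 0 0)%:C - (f 0%N)%:C * (M 0 1)%:C) * u^*.
  by rewrite rmorphM /= [(k%:C)^*]conjc_real /k fmorph_div rmorphB rmorphM.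
have := @coupled_bcP _ (f 0%N)%:C (f N)%:C (M 0 0)%:C (M 0 1)%:C (M 1 0)%:C
  (M 1 1)%:C u u^* Y0 Y1 YN YN1.
rewrite -!rmorphM -!rmorphB -/a -/b det22 !fmorph_eq0 => /(_ erefl uu) P.
have {}P := P (lt0r_neq0 a_gt0) f0_neq0.
rewrite conjk /c0 /cn /k !(rmorphB, fmorph_div, rmorphM, rmorphXn) /=.
rewrite !(rmorphB, rmorphM) /= in P *.
apply: iff_trans P; split.
  by move=> h; split; [have := h 0|have := h 1];
    rewrite !mxE /= oppr0 mul0r addr0 mulN1r.
case=> h1 h2 r; case: (unliftP 0 r) => [r'|] ->;
  rewrite ?ord1 !mxE /= oppr0 mul0r addr0 mulN1r //.
by rewrite (_ : lift 0 0 = 1) //; apply: val_inj.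
Qed.

Lemma coupled_eig_list (u : C) : u * u^* = 1 ->
  exists V, let s := eig_list N f q w (u *: cmx M) (- 1%:M) in
    [/\ size s = N, sorted <=%R s & resolves (per_jacobi n f q c0 cn (k%:C * u))
          (weight n w) V (realrow N (nth 0 s))].
Proof. by move=> uu; apply: per_eig_list => *; apply: bc_coupled. Qed.

Lemma coupled_eig_parity (u v : C) : (0 < n)%N ->
  0 < \prod_(i < N) (f i)^-1 -> u * u^* = 1 -> v * v^* = 1 ->
  complex.Re v < complex.Re u -> forall j, (j < N)%N ->
  let l (x : C) := eig N f q w (x *: cmx M) (- 1%:M) j in
  if ~~ odd j then l u < l v else l v < l u.
Proof.
move=> n0 fpos uu vv ltuv.
have [Vu [szu ou ru]] := coupled_eig_list uu.
have [Vv [szv ov rv]] := coupled_eig_list vv.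
(* The forms differ only in terms containing the first coordinate; the single constraint [x_0 = 0]
   costs one index in the interlacing. *)
have Lform z z' (x : 'rV[C]_N) : x *m (delta_mx 0 0 : 'cV_N) = 0 ->
    (x *m per_jacobi n f q c0 cn z *m x^t*) 0 0 <=
    (x *m per_jacobi n f q c0 cn z' *m x^t*) 0 0.
  rewrite -colE => /matrixP/(_ 0 0) e.
  have x0 : x 0 0 = 0 by move: e; rewrite !mxE.
  by rewrite !per_jacobi_form x0 rmorph0 !mul0r !mulr0.
apply: interlaced_roots_parity.
  move=> i j /andP[ij jN]; have iN := ltn_trans ij jN; split.
    by apply: (resolved_le szu szv ou ov ru rv (Lform _ _)) => //; lia.
  by apply: (resolved_le szv szu ov ou rv ru (Lform _ _)) => //; lia.
move=> x; rewrite -subr_gt0.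
pose D := \prod_(i < N) w i.+1.
have D0 : 0 < D by apply: prodr_gt0 => i _; apply: w_gt0; rewrite /= ltn_ord.
have detW : \det (weight n w) = D%:C.
  by rewrite det_diag /D rmorph_prod; apply: eq_bigr => i _; rewrite mxE.
clearbody D.
have detE y V : resolves (per_jacobi n f q c0 cn (k%:C * y)) (weight n w) V
      (realrow N (nth 0 (eig_list N f q w (y *: cmx M) (- 1%:M)))) ->
    \det (per_jacobi n f q c0 cn (k%:C * y) - x%:C *: weight n w) =
    (D * \prod_(i < N) (eig N f q w (y *: cmx M) (- 1%:M) i - x))%:C.
  move=> r; rewrite (resolves_det _ r) detW rmorphM /= rmorph_prod.
  by congr (_ * _); apply: eq_bigr => i _; rewrite mxE rmorphB.
have kconj y : (k%:C * y)^* = k%:C * y^*.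
  by rewrite rmorphM /= [(k%:C)^*]conjc_real.
have knorm y : y * y^* = 1 -> k%:C * y * (k%:C * y)^* = k%:C * k%:C.
  by move=> yy; rewrite kconj mulrACA yy mulr1.
have := per_jacobi_det f q w c0 cn x%:C n0
  (etrans (knorm v vv) (esym (knorm u uu))).
rewrite (detE _ _ ru) (detE _ _ rv) !kconj -!mulrDr !addcJ.
have -> : 2 = 2%:C :> C by rewrite rmorph_nat.
rewrite -!rmorphM -!rmorphB -rmorphM => /(@complexI _ _ _) e.
rewrite -(pmulr_rgt0 _ D0) mulrBr e.
(* This is [f_0 ... f_{N-1} / a]: the factor [f_0] comes from [k]. *)
have fk : 0 < \prod_(i < n) f i.+1 * k.
  move: fpos; rewrite prodfV invr_gt0 big_ord_recl => fpos.
  by rewrite /k mulrA mulrC mulr_gt0 ?invr_gt0 // mulrC.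
rewrite -mulrBr mulrA -mulrBr; apply: mulr_gt0 => //.
by rewrite mulr_gt0 // subr_gt0.
Qed.

Lemma coupled_form_separated (u : C) (x : 'rV[C]_N) : u * u^* = 1 -> b != 0 ->
  let t := u * x 0 ord_max - (f 0%N / b)%:C * x 0 0 in
  (x *m per_jacobi n f q c0 cn (k%:C * u) *m x^t*) 0 0 -
  (x *m per_jacobi n f q (- (f 0%N ^+ 2 * M 1 1 / b)) (- f N) 0 *m x^t*) 0 0
    = (b / a)%:C * (t * t^*).
Proof.
move=> uu b0 t.
have tc : t^* = u^* * (x 0 ord_max)^* - (f 0%N / b)%:C * (x 0 0)^*.
  rewrite /t rmorphB [X in X - _]rmorphM [X in _ - X]rmorphM /=.
  by rewrite [((f 0%N / b)%:C)^*]conjc_real.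
have kconj : (k%:C * u)^* = k%:C * u^*.
  by rewrite rmorphM /= [(k%:C)^*]conjc_real.
rewrite tc /t {t tc} !per_jacobi_form kconj rmorph0 oppr0 !mul0r !addr0.
have add4 (J A B D E P Q T : C) :
    A + B + D + E = P + Q + T -> J + A + B + D + E - (J + P + Q) = T.
  move=> e; apply/eqP; rewrite subr_eq [T + _]addrC.
  by rewrite -!addrA in e *; rewrite e.
apply: add4.
have := @coupled_form_sub _ (f 0%N)%:C (f N)%:C (M 0 0)%:C (M 0 1)%:C
  (M 1 0)%:C (M 1 1)%:C u u^* (x 0 0) (x 0 0)^* (x 0 ord_max) (x 0 ord_max)^*.
rewrite -!rmorphM -!rmorphB -/a -/b det22 !fmorph_eq0 => /(_ erefl uu).
move=> /(_ (lt0r_neq0 a_gt0) b0) e.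
rewrite /c0 /cn /k.
rewrite !(rmorphN, rmorphB, fmorph_div, rmorphM, rmorphXn) /= in e *.
by rewrite expr2 in e.
Qed.

Section Separated.
Variable K : 'M[R]_2.
Hypothesis KM : M = K \/ M = - K.
Let lV := eig_list N f q w (VK_A K) (VK_B R).

(** Replacing [K] by [-K] only changes the sign of the first row, so the condition can be read off
    [M]. *)
Lemma bc_separated Y0 Y1 YN YN1 : bc n f (VK_A K) (VK_B R) Y0 Y1 YN YN1 <->
  (f 0%N * M 1 1)%:C * Y1 = b%:C * Y0 /\ YN1 = YN.
Proof.
have fN : (f N)%:C != 0 by rewrite fmorph_eq0 f_neq0.
have row0 : (K 1 0)%:C * Y0 + (K 1 1)%:C * ((f 0%N)%:C * (Y1 - Y0)) = 0 <->
    (f 0%N * M 1 1)%:C * Y1 = b%:C * Y0.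
  rewrite /b rmorphB !rmorphM /=; case: KM => ->; rewrite ?mxE ?rmorphN;
    split=> [h|h]; apply/eqP.
  - by rewrite -subr_eq0 -h; apply/eqP; ring.
  - by move/eqP: h; rewrite -subr_eq0 => /eqP <-; apply/eqP; ring.
  - by rewrite -subr_eq0 -oppr_eq0 -h; apply/eqP; ring.
  - by move/eqP: h; rewrite -subr_eq0 -oppr_eq0 => /eqP <-; apply/eqP; ring.
have row1 : (f N)%:C * (YN1 - YN) = 0 <-> YN1 = YN.
  split=> [/eqP|->]; last by rewrite subrr mulr0.
  by rewrite mulf_eq0 (negPf fN) subr_eq0 => /eqP.
rewrite -row0 -row1; split.
  by move=> h; split; [have := h 0|have := h 1];
    rewrite !mxE /= !mul0r ?mul1r ?addr0 ?add0r.
by case=> h0 h1 r; case: (unliftP 0 r) => [r'|] ->;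
  rewrite ?ord1 !mxE /= !mul0r ?mul1r ?addr0 ?add0r.
Qed.

Lemma separated_eig_list : b != 0 ->
  exists V, [/\ size lV = N, sorted <=%R lV &
    resolves (per_jacobi n f q (- (f 0%N ^+ 2 * M 1 1 / b)) (- f N) 0)
          (weight n w) V (realrow N (nth 0 lV))].
Proof.
move=> b0; apply: per_eig_list => Y0 Y1 YN YN1.
have bC : b%:C != 0 by rewrite fmorph_eq0.
have fC : (f 0%N)%:C != 0 by rewrite fmorph_eq0.
have fN : (f N)%:C != 0 by rewrite fmorph_eq0 f_neq0.
apply: (iff_trans (bc_separated _ _ _ _)).
rewrite rmorph0 !mul0r !sub0r !rmorphN !mulNr !opprK fmorph_div !rmorphM /=.
split=> -[h1 h2]; split.
- by apply: (mulfI bC); rewrite mulrCA -h1; field.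
- by rewrite h2.
- by apply: (mulfI fC); rewrite [RHS]mulrCA h1; field.
- exact: (mulfI fN).
Qed.

Section Compare.
Variable u : C.
Hypothesis uu : u * u^* = 1.
Let lu := eig_list N f q w (u *: cmx M) (- 1%:M).

(** The column of the linear form [t]; on its kernel the coupled and separated forms agree. *)
Let L : 'cV[C]_N :=
  u *: delta_mx ord_max 0 - (f 0%N / b)%:C *: delta_mx 0 0.

Let L_kernel (x : 'rV[C]_N) : x *m L = 0 ->
  u * x 0 ord_max - (f 0%N / b)%:C * x 0 0 = 0.
Proof.
move=> /matrixP/(_ 0 0).
by rewrite mulmxBr -!scalemxAr -!colE !mxE.
Qed.

(** The coupled form dominates the separated one everywhere, giving the first bound with [d = 0];
    equality on the kernel of [L] gives the second with [d = 1]. *)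
Lemma separated_eig_gt0 : 0 < b ->
  (forall j, (j < N)%N -> lV`_j <= lu`_j) /\
  (forall j, (j.+1 < N)%N -> lu`_j <= lV`_j.+1).
Proof.
move=> b0; have bn0 := lt0r_neq0 b0.
have [V [szV oV rV]] := separated_eig_list bn0.
have [U [szu ou ru]] := coupled_eig_list uu.
split=> j jN.
  have dim : (N + 0 + j <= N + j)%N by rewrite addn0.
  apply: (resolved_le (L := 0) szV szu oV ou rV ru _ jN jN dim) => x _.
  rewrite -subr_ge0 (coupled_form_separated x uu bn0).
  by rewrite mulr_ge0 ?mul_conjC_ge0 // ler0c ltW // divr_gt0.
have dim : (N + 1 + j <= N + j.+1)%N by lia.
apply: (resolved_le szu szV ou oV ru rV _ (ltnW jN) jN dim) => x /L_kernel t0.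
rewrite -subr_ge0 -opprB (coupled_form_separated x uu bn0) t0.
by rewrite mul0r mulr0 oppr0.
Qed.

Lemma separated_eig_lt0 : b < 0 ->
  (forall j, (j < N)%N -> lu`_j <= lV`_j) /\
  (forall j, (j.+1 < N)%N -> lV`_j <= lu`_j.+1).
Proof.
move=> b0; have bn0 := ltr0_neq0 b0.
have [V [szV oV rV]] := separated_eig_list bn0.
have [U [szu ou ru]] := coupled_eig_list uu.
split=> j jN.
  have dim : (N + 0 + j <= N + j)%N by rewrite addn0.
  apply: (resolved_le (L := 0) szu szV ou oV ru rV _ jN jN dim) => x _.
  rewrite -subr_ge0 -opprB (coupled_form_separated x uu bn0) oppr_ge0.
  rewrite mulr_le0_ge0 ?mul_conjC_ge0 // -[0]/(0%:C) lecR ltW //.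
  by rewrite pmulr_llt0 ?invr_gt0.
have dim : (N + 1 + j <= N + j.+1)%N by lia.
apply: (resolved_le szV szu oV ou rV ru _ (ltnW jN) jN dim) => x /L_kernel t0.
rewrite -subr_ge0 (coupled_form_separated x uu bn0) t0.
by rewrite mul0r mulr0.
Qed.

Lemma separated_eig_eq0 : (0 < n)%N -> b = 0 ->
  forall j, (j < n)%N -> lu`_j <= lV`_j <= lu`_j.+1.
Proof.
move=> n0 b0 j jn.
have bcP Y0 Y1 YN YN1 : bc n f (VK_A K) (VK_B R) Y0 Y1 YN YN1 <->
    Y1 = 0 /\ YN1 = YN.
  apply: (iff_trans (bc_separated _ _ _ _)); rewrite b0 rmorph0 mul0r.
  (* If [m_22] vanished, [b = 0] would force [m_21 = 0] and the determinant would be 0. *)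
  have nz : (f 0%N * M 1 1)%:C != 0.
    rewrite fmorph_eq0 mulf_neq0 //; apply/eqP => m0; move: det22 b0.
    rewrite /b m0 !mulr0 !sub0r => h /eqP; rewrite oppr_eq0 => /eqP m10.
    by move/eqP: h; rewrite m10 mulr0 oppr0 eq_sym oner_eq0.
  split=> -[h ->]; split=> //; last by rewrite h mulr0.
  by apply: (mulfI nz); rewrite h mulr0.
have [V [szV oV rV]] := trunc_eig_list c0 (k%:C * u) n0 bcP.
have [U [szu ou ru]] := coupled_eig_list uu.
have cnE : cn = - f N by rewrite /cn b0 mul0r sub0r.
rewrite cnE in ru.
apply/andP; split.
  (* There is no linear constraint here; the index shift comes from the compression having only [n]
     eigenvalues. *)
  by apply: (resolved_le (L := 0 : 'M_(N, 0)) szu szV ou oV ru rV) => //; lia.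
by apply: (resolved_le (L := 0 : 'M_(N, 0)) szV szu oV ou rV ru) => //; lia.
Qed.
End Compare.

End Separated.

End Coupled.

End Spectra.

(** * The phases [1], [-1], [e^{i gamma}] and the final assembly *)

(** Makes [M] and [-M] instances of the phase problem, so that the results for a unimodular [u]
    apply to all three coupled conditions. *)
Lemma cmx_sign (R : realType) (M : 'M[R]_2) (b : bool) :
  exists u : R[i], [/\ u * u^* = 1, complex.Re u = (-1) ^+ b &
    cmx ((-1) ^+ b *: M) = u *: cmx M].
Proof.
exists (real_complex R ((-1) ^+ b)); split=> //.
  rewrite [X in _ * X]conjc_real -rmorphM -expr2 sqrr_sign.
  by rewrite rmorph1.
by apply/matrixP => i j; rewrite !mxE rmorphM.
Qed.

Lemma cos_lt1 (R : realType) (x : R) :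
  (- pi < x < 0) \/ (0 < x < pi) -> -1 < cos x < 1.
Proof.
move=> hx; have s0 : sin x != 0.
  case: hx => hx; last by rewrite gt_eqF // sin_gt0_pi.
  rewrite -[x]opprK sinN oppr_eq0 gt_eqF // sin_gt0_pi //.
  by rewrite oppr_gt0 ltrNl andbC.
have := cos2Dsin2 x; have : 0 < sin x ^+ 2 by rewrite exprn_even_gt0.
by move=> s2 e; apply/andP; split; nra.
Qed.

Theorem theorem3p11 (R : realType) (N : nat) (f q w : nat -> R)
  (gamma : R) (K : 'M[R]_2) :
  (2 <= N)%N ->
  (forall n, (n <= N)%N -> f n != 0) ->
  (forall n, (1 <= n <= N)%N -> 0 < w n) ->
  0 < \prod_(i < N) (f i)^-1 ->
  ((- pi < gamma < 0) \/ (0 < gamma < pi)) ->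
  \det K = 1 ->
  K 0 0 - f 0%N * K 0 1 != 0 ->
  forall M : 'M[R]_2, M = K \/ M = - K ->
  let lam (A : 'M[R[i]]_2) (j : nat) := eig N f q w A (- 1%:M) j in
  let lM j := lam (cmx M) j in
  let lmM j := lam (cmx (- M)) j in
  let lg j := lam (expi gamma *: cmx M) j in
  let lV j := eig N f q w (VK_A K) (VK_B R) j in
  let mn j := Num.min (lM j) (lmM j) in
  let mx j := Num.max (lM j) (lmM j) in
  let P := forall j, (j < N)%N ->
      if ~~ odd j then lM j < lg j < lmM j else lmM j < lg j < lM j in
  let a := M 0 0 - f 0%N * M 0 1 in
  let b := f 0%N * M 1 1 - M 1 0 in
  (0 < a -> 0 < b ->
     [/\ P, (forall j, (j < N)%N -> lV j <= mn j)
          & (forall j, (j <= N - 2)%N -> mx j <= lV j.+1)]) /\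
  (0 < a -> b < 0 ->
     [/\ P, (forall j, (j <= N - 2)%N -> mx j <= lV j <= mn j.+1)
          & mx (N - 1)%N <= lV (N - 1)%N]) /\
  (0 < a -> b = 0 ->
     P /\ (forall j, (j <= N - 2)%N -> mx j <= lV j <= mn j.+1)).
Proof.
(* For [N = n.+1] the bound [2 <= N] is [0 < n] by computation. *)
case: N => [|n] // n0 f0 w0 fpos gpi detK _ M KM.
have detM : \det M = 1.
  by case: KM => ->; rewrite // !det_mx22 !mxE !mulrNN -det_mx22.
have [p [pp Rep cp]] := cmx_sign M false.
have [m [mm Rem cm]] := cmx_sign M true.
rewrite expr0 scale1r in Rep cp; rewrite expr1 scaleN1r in Rem cm.
have one3 : expi gamma * (expi gamma)^* = 1.
  by rewrite -normCK -add_Re2_Im2 /= cos2Dsin2.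
have /andP[g1 g2] := cos_lt1 gpi.
rewrite -[cos gamma]/(complex.Re (expi gamma)) -Rem in g1.
rewrite -[cos gamma]/(complex.Re (expi gamma)) -Rep in g2.
move=> lam lM lmM lg lV mn mx P a b.
have lME j : lM j = lam (p *: cmx M) j := congr1 (lam^~ j) cp.
have lmME j : lmM j = lam (m *: cmx M) j := congr1 (lam^~ j) cm.
(* The real parts satisfy [-1 < cos gamma < 1]; applying the parity comparison to the two
   neighbouring pairs of phases gives both halves of the chain. *)
have PP : 0 < a -> P.
  move=> a0 j jN; rewrite (lME j) (lmME j).
  have := coupled_eig_parity q f0 w0 detM a0 n0 fpos pp one3 g2 jN.
  have := coupled_eig_parity q f0 w0 detM a0 n0 fpos one3 mm g1 jN.
  by case: (odd j) => h1 h2; apply/andP; [exact: conj h1 h2|exact: conj h2 h1].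
have minP x j :
    (forall u : R[i], u * u^* = 1 -> x <= lam (u *: cmx M) j) -> x <= mn j.
  by move=> h; rewrite /mn le_min (lME j) (lmME j) (h p pp) (h m mm).
have maxP x j :
    (forall u : R[i], u * u^* = 1 -> lam (u *: cmx M) j <= x) -> mx j <= x.
  by move=> h; rewrite /mx ge_max (lME j) (lmME j) (h p pp) (h m mm).
split; [|split] => a0 b0; (split; first exact: PP).
- move=> j jN; apply: minP => u uu.
  by have [h _] := separated_eig_gt0 q f0 w0 detM a0 KM uu b0; apply: h.
- move=> j jN; apply: maxP => u uu.
  by have [_ h] := separated_eig_gt0 q f0 w0 detM a0 KM uu b0; apply: h; lia.
- move=> j jN; apply/andP; split; [apply: maxP|apply: minP] => u uu;
  have [h1 h2] := separated_eig_lt0 q f0 w0 detM a0 KM uu b0.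
    by apply: h1; lia.
  by apply: h2; lia.
- apply: maxP => u uu.
  by have [h _] := separated_eig_lt0 q f0 w0 detM a0 KM uu b0; apply: h; lia.
- move=> j jN; have jn : (j < n)%N by lia.
  apply/andP; split; [apply: maxP|apply: minP] => u uu;
    have /andP[h1 h2] := separated_eig_eq0 q f0 w0 detM a0 KM uu n0 b0 jn.
    exact: h1.
  exact: h2.
Qed.
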